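(* Let $X$ be an ergodic (irreducible and aperiodic) discrete-time homogeneous Markov chain on a finite state space $\mathcal{X}$ with transition matrix $P$, and let $\Omega=(\Omega_{i,j})_{i,j\in\mathcal{X}}$ be its resistance distance. Then for all $i,j,k\in\mathcal{X}$: (1) (non-negativity) $\Omega_{i,j}\ge 0$, and equality holds if and only if $i=j$. (2) (symmetry) $\Omega_{i,j}=\Omega_{j,i}$. (3) (triangle inequality) If $P$ is doubly stochastic (all row sums and all column sums equal $1$), then $\Omega_{i,j}\le\Omega_{i,k}+\Omega_{k,j}$. In other words, $\Omega$ defines a semi-metric on $\mathcal{X}$ in general, and is a metric when $P$ is doubly stochastic.
   Context: Let $\pi$ be the stationary distribution of $X$ (a row vector), $\Pi$ the $|\mathcal{X}|\times|\mathcal{X}|$ matrix each of whose rows is $\pi$, and $I$ the identity matrix of the same size. The fundamental matrix of $X$ is $F=(F_{i,j})_{i,j\in\mathcal X}:=(I-P+\Pi)^{-1}$ (the inverse always exists). The resistance distance of the Markov chain is $\Omega_{i,j}:=F_{i,i}+F_{j,j}-F_{i,j}-F_{j,i}$ for $i,j\in\mathcal{X}$. A semi-metric is a function satisfying the axioms of a metric except possibly the triangle inequality. *)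

(* Defs.v *)
From mathcomp Require Import all_boot all_order all_algebra.
From mathcomp Require Import reals.

Set Implicit Arguments.
Unset Strict Implicit.
Unset Printing Implicit Defensive.

Import Order.TTheory GRing.Theory Num.Theory.
Local Open Scope ring_scope.

(* A finite-state homogeneous chain is represented by its transition matrix,
   acting on row vectors from the right: P i j is the probability of moving
   from i to j in one step, and (P ^+ t) i j of doing so in t steps. *)

Definition transition_matrix (R : realType) (n : nat) (P : 'M[R]_n) : Prop :=
  (forall i j, 0 <= P i j) /\ (forall i, \sum_j P i j = 1).

Definition doubly_stochastic (R : realType) (n : nat) (P : 'M[R]_n) : Prop :=
  transition_matrix P /\ (forall j, \sum_i P i j = 1).

Definition chain_irreducible (R : realType) (n : nat) (P : 'M[R]_n) : Prop :=
  forall i j, exists t : nat, 0 < (P ^+ t) i j.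

(* d is the gcd of the set of possible return times of i; this set is possibly
   infinite, hence the characterization of the gcd by its universal property. *)
Definition is_period (R : realType) (n : nat) (P : 'M[R]_n) (i : 'I_n)
    (d : nat) : Prop :=
  let return_time t := (0 < t)%N /\ 0 < (P ^+ t) i i in
  (forall t, return_time t -> (d %| t)%N) /\
  (forall e, (forall t, return_time t -> (e %| t)%N) -> (e %| d)%N).

Definition chain_aperiodic (R : realType) (n : nat) (P : 'M[R]_n) : Prop :=
  forall i, is_period P i 1.

Definition ergodic (R : realType) (n : nat) (P : 'M[R]_n) : Prop :=
  chain_irreducible P /\ chain_aperiodic P.

Definition stationary_distribution (R : realType) (n : nat) (P : 'M[R]_n)
    (pi : 'rV[R]_n) : Prop :=
  [/\ forall i, 0 <= pi 0 i, \sum_i pi 0 i = 1 & pi *m P = pi].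

Definition stationary_matrix (R : realType) (n : nat) (pi : 'rV[R]_n) :
    'M[R]_n :=
  \matrix_(i, j) pi 0 j.

(* For pi the stationary distribution of an ergodic P the matrix inverted here
   is always a unit, so the default value of invmx is never used. *)
Definition fundamental_matrix (R : realType) (n : nat) (P : 'M[R]_n)
    (pi : 'rV[R]_n) : 'M[R]_n :=
  invmx (1%:M - P + stationary_matrix pi).

Definition resistance_distance (R : realType) (n : nat) (P : 'M[R]_n)
    (pi : 'rV[R]_n) (i j : 'I_n) : R :=
  let F := fundamental_matrix P pi in F i i + F j j - F i j - F j i.

Definition is_semimetric (R : realType) (T : Type) (d : T -> T -> R) : Prop :=
  [/\ forall x y, 0 <= d x y,
      forall x y, d x y = 0 <-> x = y &
      forall x y, d x y = d y x].

Definition is_metric (R : realType) (T : Type) (d : T -> T -> R) : Prop :=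
  is_semimetric d /\ (forall x y z, d x y <= d x z + d z y).

(* Main.v *)
Require Import Defs.
From mathcomp Require Import all_boot all_order all_algebra.
From mathcomp Require Import reals.
From mathcomp Require Import ring lra.

(** Everything follows from the maximum principle: for an irreducible chain, a
    function that is subharmonic at every state except possibly [k] is maximal
    at [k] ([maximum_principle]).  Since [pi] is fixed by [F], the fundamental
    matrix solves the Poisson equation [(I - P) F = I - Pi]
    ([fundamental_poisson]), so the [j]-th column of [F] solves
    [(I - P) v = e_j - pi_j 1].

    Off [j] this column is subharmonic with strict excess [pi_j > 0], hence it
    has a strict maximum at [j] ([fundamental_lt_diag]).  Probabilistically,
    [F j j - F i j] is [pi_j] times the mean hitting time of [j] from [i].  As
    [Omega i j = (F j j - F i j) + (F i i - F j i)], positivity follows.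

    If [P] is doubly stochastic then [pi] is uniform, so the constants cancel in
    the difference of the columns [k] and [j] of [F], which solves
    [(I - P) w = e_k - e_j] and is subharmonic off [k].  Its maximality at [k]
    reads [F i k + F k j <= F k k + F i j]: up to the common factor [pi], this is
    the triangle inequality for mean hitting times
    ([fundamental_triangle]).  Adding it to its instance with [i] and [j]
    exchanged gives the triangle inequality for [Omega], a rescaled commute
    time. *)

Set Implicit Arguments.
Unset Strict Implicit.
Unset Printing Implicit Defensive.

Import Order.TTheory GRing.Theory Num.Theory.
Local Open Scope ring_scope.

(** A chain that cannot leave [A] in one step cannot leave it in any number of
    steps.  Irreducibility is used in this form only: [A] is the support of
    [pi] in [stationary_gt0], and a set of maximizers in
    [maximum_principle]. *)
Lemma irreducible_closed_set (R : realType) (n : nat) (P : 'M[R]_n)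
    (A : pred 'I_n) :
  chain_irreducible P ->
  (forall i l, A i -> ~~ A l -> P i l = 0) ->
  forall i l, A i -> A l.
Proof.
move=> Pirr Aclosed i l Ai; apply/negPn/negP => nAl.
have Pt0 t : forall m, ~~ A m -> (P ^+ t) i m = 0.
  elim: t => [|t IHt] m nAm.
    rewrite expr0 mxE; case: eqP => // im.
    by move: nAm; rewrite -im Ai.
  rewrite exprSr mxE big1 // => s _.
  have [As|nAs] := boolP (A s); first by rewrite Aclosed ?mulr0.
  by rewrite IHt ?mul0r.
by have [t] := Pirr i l; rewrite Pt0 ?ltxx.
Qed.

(** A state where the global maximum [M] is attained and where [f] is
    subharmonic sends all its mass to states with value [M].  So if [k] were
    not a maximizer, the set of maximizers would be closed, contradicting
    irreducibility. *)
Lemma maximum_principle (R : realType) (n : nat) (P : 'M[R]_n)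
    (f : 'I_n -> R) (k : 'I_n) :
  transition_matrix P -> chain_irreducible P ->
  (forall i, i != k -> f i <= \sum_l P i l * f l) ->
  forall i, f i <= f k.
Proof.
move=> [P_ge0 P_sum1] Pirr fsub i.
have [m _ fmax] := Order.TotalTheory.arg_maxP f (isT : xpredT k).
have fm l : f l <= f m by exact: fmax.
suff /eqP -> : f k == f m by [].
case: (eqVneq (f k) (f m)) => // fkm.
have closed s l : f s == f m -> f l != f m -> P s l = 0.
  move=> /eqP fs fl.
  have sk : s != k by apply: contraNneq fkm => <-; rewrite fs.
  have gap_ge0 r : true -> 0 <= P s r * (f m - f r).
    by move=> _; rewrite mulr_ge0 ?subr_ge0.
  have gap0 : \sum_r P s r * (f m - f r) = 0.
    apply/eqP; rewrite eq_le sumr_ge0 // andbT.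
    under eq_bigr do rewrite mulrBr.
    by rewrite sumrB -mulr_suml P_sum1 mul1r subr_le0 -{1}fs fsub.
  have /eqP := psumr_eq0P gap_ge0 gap0 (i := l) isT.
  by rewrite mulf_eq0 subr_eq0 [f m == _]eq_sym (negPf fl) orbF => /eqP.
have := irreducible_closed_set (A := fun s => f s == f m) Pirr closed
  (i := m) k (eqxx _).
by rewrite (negPf fkm).
Qed.

(** The support of [pi] is closed: by stationarity, mass that flowed from it
    into [l] would make [pi 0 l] positive. *)
Lemma stationary_gt0 (R : realType) (n : nat) (P : 'M[R]_n) (pi : 'rV[R]_n) :
  transition_matrix P -> chain_irreducible P -> stationary_distribution P pi ->
  forall i, 0 < pi 0 i.
Proof.
move=> [P_ge0 _] Pirr [pi_ge0 pi_sum1 piP] i.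
have [s s_gt0] : exists s, 0 < pi 0 s.
  apply/existsP; apply: contraT; rewrite negb_exists => /forallP pi_le0.
  have := @oner_neq0 R; rewrite -pi_sum1 big1 ?eqxx // => l _.
  by apply/eqP; rewrite eq_le pi_ge0 leNgt pi_le0.
apply: (irreducible_closed_set (A := fun l => 0 < pi 0 l) Pirr _ i s_gt0).
move=> r l r_gt0; rewrite -leNgt => l_le0.
have pil0 : \sum_r pi 0 r * P r l = 0.
  have /rowP/(_ l) := piP; rewrite mxE => ->.
  by apply/eqP; rewrite eq_le l_le0 pi_ge0.
have flow_ge0 s' : true -> 0 <= pi 0 s' * P s' l by move=> _; rewrite mulr_ge0.
have /eqP := psumr_eq0P flow_ge0 pil0 (i := r) isT.
by rewrite mulf_eq0 gt_eqF //= => /eqP.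
Qed.

Lemma mul_row_stationary_matrix (R : realType) (n : nat) (pi r : 'rV[R]_n) :
  r *m stationary_matrix pi = (\sum_i r 0 i) *: pi.
Proof.
apply/rowP => j; rewrite !mxE mulr_suml.
by apply: eq_bigr => i _; rewrite mxE.
Qed.

(** A column [v] with [(I - P + Pi) v = 0] has [pi v = 0], since
    [pi (I - P + Pi) = pi]; it is then harmonic, hence constant, and the
    constant is its [pi]-average [0]. *)
Lemma fundamental_unit (R : realType) (n : nat) (P : 'M[R]_n)
    (pi : 'rV[R]_n) :
  transition_matrix P -> chain_irreducible P -> stationary_distribution P pi ->
  1%:M - P + stationary_matrix pi \in unitmx.
Proof.
move=> Ptr Pirr [pi_ge0 pi_sum1 piP].
rewrite unitmxE unitfE -det_tr; apply/det0P => -[u u_neq0 uA].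
set A := 1%:M - P + _ in uA.
have Av : A *m u^T = 0 by rewrite -[A]trmxK -trmx_mul uA trmx0.
have piA : pi *m A = pi.
  rewrite mulmxDr mulmxBr mulmx1 piP subrr add0r.
  by rewrite mul_row_stationary_matrix pi_sum1 scale1r.
have piv : pi *m u^T = 0 by rewrite -piA -mulmxA Av mulmx0.
have mean0 : \sum_l pi 0 l * u 0 l = 0.
  move/matrixP: piv => /(_ 0 0); rewrite !mxE => piv.
  by rewrite -[RHS]piv; apply: eq_bigr => l _; rewrite mxE.
have harm i : u 0 i = \sum_l P i l * u 0 l.
  move/matrixP: Av => /(_ i 0).
  rewrite mulmxDl mulmxBl mul1mx !mxE.
  rewrite (eq_bigr (fun l => P i l * u 0 l)) => [|l _]; last by rewrite mxE.
  rewrite [X in _ + X = _](eq_bigr (fun l => pi 0 l * u 0 l)) => [|l _].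
    by rewrite mean0 addr0 => /eqP; rewrite subr_eq0 => /eqP.
  by rewrite !mxE.
have u_le i k : u 0 i <= u 0 k.
  by apply: (maximum_principle Ptr Pirr) => s _; rewrite -harm.
case/eqP: u_neq0; apply/rowP => k; rewrite mxE -mean0 -[LHS]mul1r -pi_sum1.
rewrite mulr_suml; apply: eq_bigr => l _.
by congr (_ * _); apply/eqP; rewrite eq_le !u_le.
Qed.

(** Both sides have the image [(\sum_i r 0 i) *: pi] under [I - P + Pi]. *)
Lemma stationary_unique (R : realType) (n : nat) (P : 'M[R]_n)
    (pi r : 'rV[R]_n) :
  transition_matrix P -> chain_irreducible P -> stationary_distribution P pi ->
  r *m P = r -> r = (\sum_i r 0 i) *: pi.
Proof.
move=> Ptr Pirr pist rP; have Aunit := fundamental_unit Ptr Pirr pist.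
have [_ pi_sum1 piP] := pist.
apply: (can_inj (mulmxK Aunit)).
rewrite -scalemxAl !mulmxDr !mulmxN !mulmx1 rP piP !subrr !add0r.
by rewrite !mul_row_stationary_matrix pi_sum1 scale1r.
Qed.

(** Unit column sums make the constant row a left fixed vector of [P], hence a
    multiple of [pi]. *)
Lemma doubly_stochastic_stationary_uniform (R : realType) (n : nat)
    (P : 'M[R]_n) (pi : 'rV[R]_n) :
  doubly_stochastic P -> chain_irreducible P -> stationary_distribution P pi ->
  forall i j, pi 0 i = pi 0 j.
Proof.
move=> [Ptr P_colsum1] Pirr pist i j; pose r : 'rV[R]_n := const_mx 1.
have rP : r *m P = r.
  apply/rowP => l; rewrite !mxE -[RHS](P_colsum1 l).
  by apply: eq_bigr => s _; rewrite mxE mul1r.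
have /rowP r_pi := stationary_unique Ptr Pirr pist rP.
have c_neq0 : \sum_l r 0 l != 0.
  apply: contraTneq (oner_neq0 R) => c0.
  by have := r_pi i; rewrite c0 scale0r !mxE => ->; rewrite eqxx.
apply: (mulfI c_neq0).
by have := r_pi i; have := r_pi j; rewrite !mxE => <- <-.
Qed.

(** The term [Pi F] of [(I - P + Pi) F = I] equals [Pi], because [pi] is a left
    fixed vector of [I - P + Pi], hence of [F]. *)
Lemma fundamental_poisson (R : realType) (n : nat) (P : 'M[R]_n)
    (pi : 'rV[R]_n) :
  transition_matrix P -> chain_irreducible P -> stationary_distribution P pi ->
  let F := fundamental_matrix P pi in
  forall i j, F i j = \sum_l P i l * F l j + (i == j)%:R - pi 0 j.
Proof.
move=> Ptr Pirr pist F i j; have Aunit := fundamental_unit Ptr Pirr pist.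
have [_ pi_sum1 piP] := pist.
have piF : pi *m F = pi.
  apply: (can_inj (mulmxK Aunit)); rewrite mulmxKV //.
  rewrite mulmxDr mulmxBr mulmx1 piP subrr add0r.
  by rewrite mul_row_stationary_matrix pi_sum1 scale1r.
have /matrixP /(_ i j) := mulmxV Aunit; rewrite -/(fundamental_matrix P pi) -/F.
rewrite mulmxDl mulmxBl mul1mx !mxE.
rewrite [X in _ + X = _](_ : _ = pi 0 j) => [<-|].
  by rewrite addrA addrK addrC subrK.
rewrite -[in RHS]piF mxE.
by apply: eq_bigr => l _; rewrite mxE.
Qed.

(** The maximum principle only gives the weak inequality; averaging it over one
    step from [i] and using the excess [pi_j > 0] of the Poisson equation at
    [i] makes it strict. *)
Lemma fundamental_lt_diag (R : realType) (n : nat) (P : 'M[R]_n)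
    (pi : 'rV[R]_n) :
  transition_matrix P -> chain_irreducible P -> stationary_distribution P pi ->
  let F := fundamental_matrix P pi in
  forall i j, i != j -> F i j < F j j.
Proof.
move=> Ptr Pirr pist F i j ij.
have pij_gt0 := stationary_gt0 Ptr Pirr pist j.
have off s : s != j -> F s j = \sum_l P s l * F l j - pi 0 j.
  by move=> /negPf sj; rewrite /F fundamental_poisson // sj addr0.
have F_le s : F s j <= F j j.
  apply: (maximum_principle (f := F^~ j) Ptr Pirr) => r rj.
  by rewrite off // gerBl ltW.
rewrite off // ltrBlDr; apply: le_lt_trans (_ : F j j < _); last by rewrite ltrDl.
have [P_ge0 P_sum1] := Ptr.
rewrite -[leRHS]mul1r -(P_sum1 i) mulr_suml.
by apply: ler_sum => l _; rewrite ler_wpM2l.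
Qed.

(** The difference of the columns [k] and [j] of [F] is subharmonic off [k]: the
    source of its Poisson equation is [-1] at [j], and [0] elsewhere because
    [pi_k = pi_j].  Without this equality the source would be [pi_j - pi_k],
    of either sign. *)
Lemma fundamental_triangle (R : realType) (n : nat) (P : 'M[R]_n)
    (pi : 'rV[R]_n) :
  doubly_stochastic P -> chain_irreducible P -> stationary_distribution P pi ->
  let F := fundamental_matrix P pi in
  forall i j k, F i k + F k j <= F k k + F i j.
Proof.
move=> Pds Pirr pist F i j k; have [Ptr _] := Pds.
suff : F i k - F i j <= F k k - F k j.
  by rewrite lerBrDr addrAC lerBlDr.
apply: (maximum_principle (f := fun s => F s k - F s j) Ptr Pirr) => s sk.
under eq_bigr do rewrite mulrBr.
rewrite sumrB /F !(fundamental_poisson Ptr Pirr pist s) (negPf sk) addr0.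
rewrite (doubly_stochastic_stationary_uniform Pds Pirr pist k j).
by have := ler0n R (s == j); lra.
Qed.

Theorem proposition1p2 (R : realType) (n : nat) (P : 'M[R]_n) (pi : 'rV[R]_n)
    (P_transition : transition_matrix P) (P_ergodic : ergodic P)
    (pi_stationary : stationary_distribution P pi) :
  let Omega := resistance_distance P pi in
  (forall i j k : 'I_n,
    [/\ 0 <= Omega i j /\ (Omega i j = 0 <-> i = j),
        Omega i j = Omega j i &
        doubly_stochastic P -> Omega i j <= Omega i k + Omega k j]) /\
  is_semimetric Omega /\
  (doubly_stochastic P -> is_metric Omega).
Proof.
move=> Omega; have [Pirr _] := P_ergodic.
pose F := fundamental_matrix P pi.
have OmegaE i j : Omega i j = (F j j - F i j) + (F i i - F j i).
  by rewrite /Omega /resistance_distance -/F; ring.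
have Omega_diag i : Omega i i = 0 by rewrite OmegaE !subrr addr0.
have Omega_gt0 i j : i != j -> 0 < Omega i j.
  move=> ij; rewrite OmegaE addr_gt0 // subr_gt0.
    exact: (fundamental_lt_diag P_transition Pirr pi_stationary).
  by apply: (fundamental_lt_diag P_transition Pirr pi_stationary); rewrite eq_sym.
have Omega_ge0 i j : 0 <= Omega i j.
  by have [->|/Omega_gt0 /ltW//] := eqVneq i j; rewrite Omega_diag.
have Omega_eq0 i j : Omega i j = 0 <-> i = j.
  split=> [Oij|->//]; apply/eqP; apply: contraT => /Omega_gt0.
  by rewrite Oij ltxx.
have Omega_sym i j : Omega i j = Omega j i by rewrite !OmegaE addrC.
have Omega_triangle i j k :
    doubly_stochastic P -> Omega i j <= Omega i k + Omega k j.
  move=> Pds; rewrite !OmegaE.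
  have := fundamental_triangle Pds Pirr pi_stationary i j k.
  have := fundamental_triangle Pds Pirr pi_stationary j i k.
  by rewrite -/F; lra.
split; first by move=> i j k; split=> //; apply: Omega_triangle.
split=> [//|Pds]; split=> // i j k; exact: Omega_triangle.
Qed.
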